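(* For all $k,\ell\in\mathbb{N}$ (positive integers), $$R_k(C_{2\ell+1})\le\left\lfloor 2\ell(2\ell-1)^{k-1}\prod_{d=2}^{k}\bigl(1+\rho_d+\rho_d^{-1}\bigr)\right\rfloor+1.$$
   Context: $C_m$ denotes the cycle on $m$ vertices. The $k$-color Ramsey number $R_k(H)$ of a graph $H$ is the smallest integer $n$ such that every edge-coloring of the complete graph $K_n$ with $k$ colors contains a monochromatic copy of $H$ (as a not necessarily induced subgraph). For fixed $\ell\ge 1$ and every integer $d\ge2$, $$\rho_d=\min\{\rho\in[1,\infty): 1+\rho+\rho^2+\cdots+\rho^\ell\ge d\}.$$ The empty product (case $k=1$) equals $1$. *)

(* Defs.v *)
From mathcomp Require Import all_boot all_order all_algebra.
Set Implicit Arguments.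
Unset Strict Implicit.
Unset Printing Implicit Defensive.
Import Order.TTheory GRing.Theory Num.Theory.

Record sgraph := SGraph {
  vertex :> finType;
  adj : rel vertex;
  adj_sym : symmetric adj;
  adj_irrefl : irreflexive adj }.

(* The first conjunct only matters for m = 1, where it prevents a loop;
   for m >= 3 this is the usual cycle on m vertices. *)
Definition cycle_adj (m : nat) : rel 'I_m :=
  fun i j => (i != j) && ((j == ordS i) || (i == ordS j)).

Lemma cycle_adj_sym m : symmetric (@cycle_adj m).
Proof. by move=> i j; rewrite /cycle_adj eq_sym orbC. Qed.

Lemma cycle_adj_irrefl m : irreflexive (@cycle_adj m).
Proof. by move=> i; rewrite /cycle_adj eqxx. Qed.

Definition cycle_graph (m : nat) : sgraph :=
  SGraph (@cycle_adj_sym m) (@cycle_adj_irrefl m).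

(* A k-edge-colouring of K_n is represented by a map on all subsets of 'I_n,
   of which only the values on the 2-element subsets (the edges) are used.
   For k >= 1 the restrictions to edges are exactly all the edge-colourings. *)
Definition mono_copy (H : sgraph) (k n : nat)
    (c : {ffun {set 'I_n} -> 'I_k}) : bool :=
  [exists i : 'I_k, exists f : {ffun H -> 'I_n},
    injectiveb f &&
    [forall u : H, forall v : H, adj u v ==> (c [set f u; f v] == i)]].

Definition arrows (k : nat) (H : sgraph) (n : nat) : bool :=
  [forall c : {ffun {set 'I_n} -> 'I_k}, mono_copy H c].

Lemma ramsey_multicolor (k : nat) (q : 'I_k -> nat) :
  exists n, forall (T : finType) (c : {set T} -> 'I_k) (A : {set T}),
    n <= #|A| ->
    exists i (B : {set T}), [/\ B \subset A, q i <= #|B| &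
      {in B &, forall x y, x != y -> c [set x; y] = i}].
Proof.
move: {2}(\sum_i q i) (leqnn (\sum_i q i)) => N.
elim: N q => [|N IHN] q.
  rewrite leqn0 sum_nat_eq0 => /forallP q0; exists 0 => T c A _.
  exists (c set0), set0; split; rewrite ?sub0set //.
    by rewrite (eqP (implyP (q0 (c set0)) isT)).
  by move=> x y; rewrite inE.
move=> leN.
have [/existsP[i0 /eqP qi0]|/existsPn qN0] := boolP [exists i, q i == 0].
  exists 0 => T c A _; exists i0, set0; rewrite sub0set qi0; split=> //.
  by move=> x y; rewrite inE.
pose q' i := fun j => if j == i then (q j).-1 else q j.
have IH i : exists n, forall (T : finType) (c : {set T} -> 'I_k) (A : {set T}),
    n <= #|A| ->
    exists j (B : {set T}), [/\ B \subset A, q' i j <= #|B| &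
      {in B &, forall x y, x != y -> c [set x; y] = j}].
  apply: IHN; rewrite -ltnS; apply: leq_trans leN.
  rewrite (bigD1 i) //= [X in _ < X](bigD1 i) //= {1}/q' eqxx.
  rewrite (eq_bigr q) => [|j /negPf ji]; last by rewrite /q' ji.
  by rewrite ltn_add2r ltn_predL lt0n qN0.
have [r Hr] := fin_all_exists IH.
exists (\sum_i r i).+2 => T c A leA.
have /set0Pn[v vA] : A != set0 by rewrite -card_gt0 (leq_trans _ leA).
pose Ac i := [set u in A :\ v | c [set v; u] == i].
have [i lei] : exists i, r i <= #|Ac i|.
  apply/existsP; apply: contraLR leA => /existsPn Hi; rewrite -ltnNge.
  rewrite (cardsD1 v A) vA add1n !ltnS.
  have -> : #|A :\ v| = \sum_i #|Ac i|.
    rewrite -sum1_card (partition_big (fun u => c [set v; u]) predT) //=.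
    apply: eq_bigr => i _; rewrite -sum1_card; apply: eq_bigl => u.
    by rewrite !inE.
  by apply: leq_sum => i _; apply: ltnW; rewrite ltnNge Hi.
have [j [B [sBA leB HB]]] := Hr i T c (Ac i) lei.
have sAcA : Ac i \subset A by apply/subsetP => u; rewrite !inE => /andP[/andP[]].
have [eji|nji] := eqVneq j i; last first.
  exists j, B; split=> //; first exact: subset_trans sBA sAcA.
  by move: leB; rewrite /q' (negPf nji).
exists i, (v |: B); split.
- by rewrite subUset sub1set vA (subset_trans sBA).
- have vB : v \notin B.
    by apply/negP => /(subsetP sBA); rewrite !inE eqxx.
  rewrite cardsU1 vB add1n; move: leB; rewrite /q' eji eqxx.
  by move: (q i) => [].
- move=> x y; rewrite !inE => /orP[/eqP->|xB] /orP[/eqP->|yB] nxy.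
  + by rewrite eqxx in nxy.
  + by move/(subsetP sBA): yB; rewrite !inE => /andP[_ /eqP].
  + by move/(subsetP sBA): xB; rewrite !inE setUC => /andP[_ /eqP].
  + by rewrite -eji HB.
Qed.

Lemma ramsey_exists (k : nat) (H : sgraph) : exists n, arrows k H n.
Proof.
have [n Hn] := ramsey_multicolor (fun _ : 'I_k => #|H|).
exists n; apply/forallP => c.
have [|i [B [_ leB HB]]] := Hn _ c [set: 'I_n]; first by rewrite cardsT card_ord.
have fB (u : H) : enum_val (widen_ord leB (enum_rank u)) \in B.
  exact: enum_valP.
have finj : injective (fun u : H => enum_val (widen_ord leB (enum_rank u))).
  move=> u v /enum_val_inj /(congr1 val) /= /ord_inj; exact: enum_rank_inj.
apply/existsP; exists i; apply/existsP.
exists [ffun u : H => enum_val (widen_ord leB (enum_rank u))].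
apply/andP; split; first by apply/injectiveP => u v; rewrite !ffunE => /finj.
apply/forallP => u; apply/forallP => v; apply/implyP => auv; rewrite !ffunE.
rewrite HB //; apply: contraTneq auv => /finj ->.
by rewrite adj_irrefl.
Qed.

Definition ramsey (k : nat) (H : sgraph) : nat := ex_minn (ramsey_exists k H).

From mathcomp Require Import classical_sets reals.
Local Open Scope ring_scope.

Definition rho_set (R : realType) (l d : nat) : set R :=
  [set r : R | 1 <= r /\ d%:R <= \sum_(0 <= i < l.+1) r ^+ i]%classic.

Arguments rho_set : clear implicits.

(* The infimum is attained when l >= 1, see rho_min. *)
Definition rho (R : realType) (l d : nat) : R := inf (rho_set R l d).

Lemma rho_min (R : realType) (l d : nat) : (0 < l)%N ->
  rho_set R l d (rho R l d) /\
  forall r, rho_set R l d r -> rho R l d <= r.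
Proof.
case: l => // l _.
suff [x xS xmin] : exists2 x, rho_set R l.+1 d x &
    forall r, rho_set R l.+1 d r -> x <= r.
  suff -> : rho R l.+1 d = x by [].
  apply/le_anti/andP; split.
    by apply: ge_inf xS; exists x => y /xmin.
  by apply: lb_le_inf => [|y /xmin //]; exists x.
pose g (r : R) := \sum_(0 <= i < l.+2) r ^+ i.
pose p : {poly R} := \sum_(0 <= i < l.+2) 'X^i - (d%:R)%:P.
have pE r : p.[r] = g r - d%:R.
  rewrite /p hornerD hornerN hornerC horner_sum; congr (_ - _).
  by apply: eq_bigr => i _; rewrite hornerXn.
have [d1|d1] := leP (d%:R : R) (g 1).
  by exists 1; [split|move=> r []].
have p1 : p.[1] <= 0 by rewrite pE subr_le0 ltW.
have g_ge (r : R) : 1 <= r -> 1 + r <= g r.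
  move=> r1; rewrite /g big_nat_recl // expr0 lerD2l.
  rewrite big_nat_recl // expr1 lerDl sumr_ge0 // => i _.
  by rewrite exprn_ge0 // (le_trans ler01).
have d1' : 1 <= d%:R :> R.
  by apply: le_trans (ltW d1); apply: le_trans (g_ge 1 (lexx _)); rewrite lerDl.
have pd : 0 <= p.[d%:R].
  rewrite pE subr_ge0; apply: le_trans (g_ge _ d1'); by rewrite lerDr.
have [|x /andP[x1 xd] /rootP] := @poly_ivt R p 1 d%:R d1'; first by rewrite p1.
rewrite pE => /eqP; rewrite subr_eq0 => /eqP gx.
exists x; first by split=> //; rewrite -/(g x) gx.
move=> r [r1 rd]; rewrite leNgt; apply/negP => rx.
suff : g r < g x by rewrite gx ltNge rd.
rewrite /g !big_nat_recl // !expr0 ltrD2l.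
rewrite !expr1 ltr_leD // ler_sum // => i _.
by rewrite lerXn2r ?nnegrE ?(le_trans ler01) // ltW.
Qed.

(* Main.v *)
Require Import Defs.
From mathcomp Require Import all_boot all_order all_algebra.
From mathcomp Require Import classical_sets reals.
From mathcomp Require Import fintype finset zify ring lra.
Set Implicit Arguments.
Unset Strict Implicit.
Unset Printing Implicit Defensive.
Import Order.TTheory GRing.Theory Num.Theory.
Local Open Scope ring_scope.

(** The theorem follows from a weighted inequality that survives induction on
    the number of vertices.  Let E c (c a colour) be finitely many graphs on a
    vertex set T which together cover all pairs and none of which contains a
    cycle of length 2l+1.  For a set X of vertices and u in X let d_X(u) be the
    number of colours in which u has a neighbour inside X, and let N_d be the
    claimed bound for d colours, with N_0 = 1.  Then every X satisfies

      sum over u in X of 1 / N_(d_X(u)) <= 1              ([sum_weight_le1]);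

    as d_X(u) <= k, taking X = T gives #|T| <= N_k.  Counting the colours at
    each vertex instead of the colours in use is what lets independent sets of
    different colours be combined: when a part of X is replaced by a subset
    that is c-isolated in what remains, each vertex of that subset loses the
    colour c, whatever happens elsewhere.

    For the induction pick v in X with d = d_X(v) minimal, and suppose d >= 2.
    Some colour c has at v a neighbourhood of weight at least 1/d of the weight
    of X - v.  Let L_i be the set of vertices of X at c-distance i from v.  If
    each of w(L_1), ..., w(L_(l+1)) exceeded rho_d times its predecessor, then
    their sum would exceed (1 + rho_d + ... + rho_d^l) w(L_1) >= d w(L_1), more
    than there is.  The first i with w(L_(i+1)) <= rho_d w(L_i) therefore
    satisfies i <= l, and w(L_(i-1)) <= w(L_i) / rho_d, so that the three
    layers around L_i weigh at most 1 + 1/rho_d + rho_d times w(L_i).  Replace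
    them by a c-independent subset J of L_i.  Every vertex of J loses the
    colour c, so its weight is multiplied by at least
    (2l-1)(1 + rho_d + 1/rho_d), and the induction hypothesis bounds w(J)
    ([prune_weight]).

    If all independent subsets of L_i are that light, L_i cannot be split into
    2l-1 of them, and then every acyclic orientation of E c on L_i has a path
    with 2l vertices ([indep_or_path], the acyclic case of the Gallai-Roy
    theorem).  Orienting along a planar order of the breadth-first tree yields
    a path which two branches of the tree close to a cycle of length 2l+1
    ([layer_path_cycle], after Erdos, Faudree, Rousseau and Schelp).

    If d = 1, all of X - v is c-adjacent to v and the path lemma alone, applied
    to X - v, gives a path with 2l vertices that v closes
    ([sum_weight_le1_one]). *)

Definition has_cycle (T : eqType) (e : rel T) (m : nat) : Prop :=
  exists p : seq T, [/\ size p = m, uniq p & cycle e p].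

(** * Independent sets and increasing paths *)

Section IncreasingPath.

Variables (R : realDomainType) (T : finType) (e : rel T) (key : T -> nat).
Variable w : T -> R.
Hypothesis e_sym : symmetric e.
Hypothesis key_inj : forall x y, e x y -> key x != key y.

Definition indep (J : {set T}) := {in J &, forall x y, ~~ e x y}.

(** The vertices of L without smaller neighbour form an independent set.
    Peeling it off costs weight at most a, and a path in the rest can be
    prolonged downwards by one vertex; so m peelings yield m+1 vertices. *)
Lemma indep_or_path (m : nat) (a : R) (L : {set T}) :
    (forall J : {set T}, J \subset L -> indep J -> \sum_(x in J) w x <= a) ->
    m%:R * a < \sum_(x in L) w x ->
  exists p : seq T, [/\ size p = m.+1, {subset p <= L} &
    sorted (fun x y => (key x < key y)%N && e x y) p].
Proof.
elim: m L => [|m IHm] L Ha.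
  rewrite mul0r => wL.
  have [x xL] : exists x, x \in L.
    apply/set0Pn; apply: contraTneq wL => ->.
    by rewrite big_set0 ltxx.
  exists [:: x]; split=> // y; by rewrite inE => /eqP->.
move=> wL.
pose B := [set y in L | [exists x in L, (key x < key y)%N && e x y]].
have sBL : B \subset L by apply/subsetP => y; rewrite inE => /andP[].
(* L :\: B is the set of vertices of L without smaller neighbour. *)
have indA : indep (L :\: B).
  suff H x y : x \in L :\: B -> y \in L :\: B -> (key x < key y)%N -> ~~ e x y.
    move=> x y xA yA; apply/negP => exy.
    have := key_inj exy; rewrite neq_ltn => /orP[lt|lt].
      by move: (H x y xA yA lt); rewrite exy.
    by move: (H y x yA xA lt); rewrite e_sym exy.
  rewrite !inE => /andP[_ xL] /andP[yB yL] lt; apply: contra yB => exy.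
  by rewrite yL; apply/existsP; exists x; rewrite xL lt.
have wB : m%:R * a < \sum_(x in B) w x.
  have := Ha _ (subsetDl L B) indA.
  move: wL; rewrite (big_setID B) /= (setIidPr sBL) -natr1.
  by lra.
have [|p [szp pB sp]] := IHm B _ wB.
  by move=> J sJ; apply: Ha; apply: subset_trans sJ sBL.
case: p szp pB sp => // y p szp pB sp.
have := pB y (mem_head _ _); rewrite inE => /andP[yL /existsP[x /andP[xL xy]]].
exists [:: x, y & p]; split; first by rewrite /= -szp.
  move=> z; rewrite inE => /orP[/eqP->//|/pB zB]; exact: (subsetP sBL).
by rewrite /= xy.
Qed.

End IncreasingPath.

(** * Odd cycles through a layer of a rooted tree *)

Section TreeCycle.

Local Open Scope nat_scope.

Variables (T : finType) (e : rel T) (lev : T -> nat) (par : T -> T) (i : nat).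
Hypothesis e_sym : symmetric e.
Hypothesis lev_par : forall x, (0 < lev x <= i) -> (lev (par x)).+1 = lev x.
Hypothesis e_par : forall x, (0 < lev x <= i) -> e x (par x).

(** The path climbs from y to the lowest common ancestor, s+1 generations up,
    and descends to x; q lists its inner vertices, which all lie in lower levels
    and hence avoid any path inside the level of x and y. *)
Lemma tree_path (s j : nat) (x y : T) :
    (s < j) -> (j <= i) -> lev x = j -> lev y = j ->
    iter s.+1 par x = iter s.+1 par y -> iter s par x != iter s par y ->
  exists q : seq T, [/\ size q = s.*2.+1, uniq q, path e y (rcons q x) &
    {in q, forall z, (lev z < j)}].
Proof.
elim: s j x y => [|s IHs] j x y sj ji lx ly.
  move=> /= pxy nxy; exists [:: par x]; split=> //.
    rewrite /= andbT pxy e_par ?ly ?sj // -pxy e_sym e_par //.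
    by rewrite lx sj.
  by move=> z; rewrite inE => /eqP->; rewrite -ltnS lev_par lx ?sj.
case: j sj ji lx ly => // j sj ji lx ly.
rewrite ![iter s.+1 _ _]iterSr => pxy nxy.
have {}pxy : iter s.+1 par (par x) = iter s.+1 par (par y) by rewrite -!iterSr.
have lpx : lev (par x) = j by apply: succn_inj; rewrite lev_par lx.
have lpy : lev (par y) = j by apply: succn_inj; rewrite lev_par ly.
have [||q [szq uq pq lq]] := IHs j (par x) (par y) _ _ lpx lpy pxy nxy.
- by [].
- exact: ltnW.
exists (par y :: rcons q (par x)); split.
- by rewrite /= size_rcons szq doubleS.
- rewrite /= mem_rcons inE rcons_uniq uq andbT.
  have qN z : lev z = j -> z \notin q.
    by move=> lz; apply/negP => /lq; rewrite lz ltnn.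
  rewrite (negPf (qN _ lpy)) qN // orbF andbT; apply: contra nxy => /eqP->; exact: eqxx.
- rewrite rcons_path /= last_rcons e_par ?ly //= pq.
  by rewrite e_sym e_par ?lx.
- move=> z; rewrite inE mem_rcons inE.
  by case/or3P=> [/eqP->|/eqP->|/lq/ltnW]; rewrite ?lpx ?lpy ?ltnSn.
Qed.

(** The digits of key t x in base #|T| are the ranks of x and of its first t
    ancestors, the oldest in front: comparing keys is comparing lines of
    descent lexicographically, which orders a level as in a plane drawing. *)
Fixpoint key (t : nat) (x : T) : nat :=
  if t is t'.+1 then enum_rank x + #|T| * key t' (par x) else enum_rank x.

Lemma key_div t x : key t.+1 x %/ #|T| = key t (par x).
Proof.
rewrite /= addnC mulnC divnMDl; last by apply/card_gt0P; exists x.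
by rewrite divn_small ?addn0 ?ltn_ord.
Qed.

Lemma key_mod t x : key t x %% #|T| = enum_rank x.
Proof.
case: t => [|t] /=; first by rewrite modn_small ?ltn_ord.
by rewrite addnC mulnC modnMDl modn_small ?ltn_ord.
Qed.

Lemma key_inj t : injective (key t).
Proof.
move=> x y kxy; apply: enum_rank_inj; apply: val_inj.
by rewrite /= -(key_mod t x) -(key_mod t y) kxy.
Qed.

(** The descendants of a given vertex are consecutive in the plane order,
    because dividing a key by #|T| passes to the parent. *)
Lemma key_convex t s x y z : (s <= t) ->
    (key t x <= key t y) -> (key t y <= key t z) ->
    iter s par x = iter s par z ->
  iter s par x = iter s par y.
Proof.
elim: s t x y z => [|s IHs] t x y z.
  move=> _ /= xy yz exz; apply: (@key_inj t); apply/eqP.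
  by rewrite eqn_leq xy exz yz.
case: t => // t st xy yz; rewrite !(iterSr _ par).
apply: (IHs t) => //; rewrite -!key_div; exact: leq_div2r.
Qed.

Lemma iter_par_root t x (v : T) : (forall z, lev z = 0 -> z = v) ->
  lev x = t -> (t <= i) -> iter t par x = v.
Proof.
move=> lev0; elim: t x => [|t IHt] x lx ti; first exact: lev0.
rewrite iterSr; apply: IHt; last exact: ltnW.
by apply: succn_inj; rewrite lev_par lx.
Qed.

(** Let s+1 be the least number of generations after which all vertices of the
    path have the same ancestor.  The ancestors s generations up are not all
    equal, so they differ at the ends of some window of m = 2l-1-2s edges: else,
    descendants being consecutive, neighbours on the path would always share
    that ancestor, as every edge lies in such a window.  The tree path between
    the ends of the window has 2s+2 edges. *)
Lemma layer_path_cycle (l : nat) (v : T) (p : seq T) :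
    (forall z, lev z = 0 -> z = v) -> (0 < i <= l) ->
    size p = l.*2 -> {in p, forall x, lev x = i} ->
    sorted (fun x y => (key i x < key i y) && e x y) p ->
  has_cycle e l.*2.+1.
Proof.
move=> lev0 /andP[i0 il] szp levp sp.
have szp0 : (0 < size p) by rewrite szp; lia.
have skey : sorted (fun x y => (key i x < key i y)) p.
  by apply: sub_sorted sp => x y /andP[].
have sE : sorted e p by apply: sub_sorted sp => x y /andP[].
have up : uniq p.
  apply: (@sorted_uniq _ (fun x y => (key i x < key i y))) => //.
    by move=> y x z; apply: ltn_trans.
  by move=> x; rewrite ltnn.
have klt a b : (a <= b < size p) -> (key i (nth v p a) <= key i (nth v p b)).
  move=> /andP[]; rewrite leq_eqVlt => /orP[/eqP->//|ab bs].
  apply: ltnW; move: a b ab bs.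
  have trk : transitive (fun x y : T => (key i x < key i y)).
    by move=> y x z; apply: ltn_trans.
  move=> a b ab bs; apply: (sorted_ltn_nth trk v skey) => //.
  by rewrite inE (ltn_trans ab bs).
pose g s a := iter s par (nth v p a).
have gconv s a b c : (s <= i) -> (a <= b <= c) -> (c < size p) ->
    g s a = g s c -> g s a = g s b.
  move=> si /andP[ab bc] cs; apply: (key_convex si); apply: klt; lia.
have szp1 : (size p).-1 < size p by rewrite ltn_predL.
pose cst s := g s 0 == g s (size p).-1.
have exc : exists s, cst s.
  by exists i; rewrite /cst /g !(@iter_par_root _ _ v) ?levp ?mem_nth.
case: (ex_minnP exc) => s cs smin.
have si : (s <= i).
  by apply: smin; rewrite /cst /g !(@iter_par_root _ _ v) ?levp ?mem_nth.
have s0 : (0 < s).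
  rewrite lt0n; apply: contraTneq cs => ->; rewrite /cst /g /= nth_uniq //; lia.
case: s s0 si cs smin => // s _ si cs smin.
have ncs : ~~ cst s by apply/negP => /smin; rewrite ltnn.
pose m := (l.*2 - s.*2).-1.
have hm : m.+1 + s.*2 = l.*2 by rewrite /m; lia.
have [a am ga] : exists2 a, (a + m < size p) & g s a != g s (a + m).
  have [/existsP[a /andP[am ga]]|/existsPn H] :=
    boolP [exists a : 'I_(size p), (a + m < size p) && (g s a != g s (a + m))].
    by exists a.
  case/negP: ncs; rewrite /cst.
  suff G b : (b < size p) -> g s b = g s 0.
    by rewrite G // ltn_predL.
  elim: b => // b IHb bs; rewrite -IHb; last exact: ltnW.
  (* A window containing both b and b.+1, pushed left to fit inside p. *)
  pose a := minn b (size p - m.+1).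
  have asz : (a < size p) by rewrite /a; lia.
  have am : (a + m < size p) by rewrite /a /m; lia.
  have := H (Ordinal asz); rewrite /= am /= negbK => /eqP gam.
  have ab : (a <= b <= a + m) by rewrite /a /m; lia.
  have ab' : (a <= b.+1 <= a + m) by rewrite /a /m; lia.
  have si' : s <= i by apply: ltnW.
  have e1 := gconv s a b.+1 (a + m) si' ab' am gam.
  by have e2 := gconv s a b (a + m) si' ab am gam; rewrite -e1 e2.
pose x := nth v p a; pose y := nth v p (a + m).
have gS : g s.+1 a = g s.+1 (a + m).
  have e1 b : b < size p -> g s.+1 0 = g s.+1 b.
    by move=> bs; apply: (gconv _ _ _ _ si _ szp1 (eqP cs)); lia.
  by rewrite -!e1 //; apply: leq_ltn_trans am; apply: leq_addr.
have asz : a < size p by apply: leq_ltn_trans am; apply: leq_addr.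
have xp : x \in p by apply: mem_nth.
have yp : y \in p by apply: mem_nth.
have [q [szq uq pq lq]] := tree_path si (leqnn i) (levp x xp) (levp y yp) gS ga.
(* x :: A is the window from x to y, and q leads back from y to x. *)
pose A := take m (drop a.+1 p).
have dE : drop a p = x :: drop a.+1 p by rewrite -drop_nth //; lia.
have szA : size A = m by rewrite size_takel // size_drop leq_subRL // addSn.
have xA : x :: A = take m.+1 (drop a p) by rewrite dE.
have lA : last x A = y.
  have -> : last x A = last x (x :: A) by [].
  rewrite -nth_last xA size_takel; last by rewrite size_drop ltn_subRL.
  by rewrite nth_take // nth_drop (set_nth_default v).
have sxA : subseq (x :: A) p.
  by rewrite xA; apply: (subseq_trans (take_subseq _ _)); apply: drop_subseq.
exists ((x :: A) ++ q); split.
- by rewrite size_cat /= szA szq addnS hm.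
- rewrite cat_uniq uq andbT (subseq_uniq sxA up) /=.
  apply/hasPn => z /lq zi; apply/negP => /(mem_subseq sxA)/levp.
  by move=> zz; rewrite zz ltnn in zi.
- rewrite /= rcons_cat cat_path lA pq andbT.
  have : sorted e (x :: A) by rewrite xA; apply: take_sorted; apply: drop_sorted.
  by [].
Qed.

End TreeCycle.

(** * Breadth-first layers *)

Section Layers.

Variables (T : finType) (e : rel T) (X : {set T}) (v : T).

Fixpoint ball (i : nat) : {set T} :=
  if i is i'.+1 then ball i' :|: [set u in X | [exists x in ball i', e x u]]
  else [set v].

(** The distance to v inside X, truncated at M: the vertices at distance M or
    more, and the unreachable ones, get the value M. *)
Definition level (M : nat) (x : T) : nat :=
  find (fun i => x \in ball i) (iota 0 M).

Lemma level_le M i x : (i < M)%N -> x \in ball i -> (level M x <= i)%N.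
Proof.
move=> iM xi; rewrite leqNgt; apply/negP => /(before_find 0%N).
by rewrite nth_iota // xi.
Qed.

Lemma level_ball M x : (level M x < M)%N -> x \in ball (level M x).
Proof.
move=> lM; have : has (fun i => x \in ball i) (iota 0 M).
  by rewrite has_find size_iota.
by move/(nth_find 0%N); rewrite nth_iota.
Qed.

Lemma level0 M x : level M.+1 x = 0%N -> x = v.
Proof.
by move=> lx; have := @level_ball M.+1 x; rewrite lx => /(_ isT); rewrite inE => /eqP.
Qed.

Lemma level_root M : level M.+1 v = 0%N.
Proof. by apply/eqP; rewrite -leqn0 level_le //= inE. Qed.

Lemma level_adj M x y : y \in X -> e x y -> ((level M x).+1 < M)%N ->
  (level M y <= (level M x).+1)%N.
Proof.
move=> yX exy lx; apply: level_le => //=; rewrite !inE yX; apply/orP; right.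
by apply/existsP; exists x; rewrite level_ball // ltnW.
Qed.

Lemma ball_sub i : v \in X -> ball i \subset X.
Proof.
move=> vX; elim: i => [|i IHi] /=; first by rewrite sub1set.
by rewrite subUset IHi; apply/subsetP => x; rewrite inE => /andP[].
Qed.

Lemma level_parent M x : v \in X -> (0 < level M x < M)%N ->
  exists y, [/\ y \in X, (level M y).+1 = level M x & e y x].
Proof.
move=> vX /andP[l0 lM]; have := level_ball lM.
case E: (level M x) l0 => [//|t] _ /=; rewrite !inE.
have tM : (t < M)%N by rewrite E in lM; exact: ltnW.
case/orP=> [xt|/andP[xX /existsP[y /andP[yt eyx]]]].
  by have := level_le tM xt; rewrite E ltnn.
exists y; split=> //; first exact: (subsetP (ball_sub t vX)).
congr _.+1; apply/eqP; rewrite eqn_leq level_le //=.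
rewrite leqNgt; apply/negP => ly.
have := @level_adj M y x xX eyx; rewrite E; lia.
Qed.

Hypothesis e_sym : symmetric e.

Lemma level_adj_eq M x y : x \in X -> y \in X -> e x y ->
    ((level M x).+1 < M)%N ->
  [\/ (level M y).+1 = level M x, level M y = level M x |
      level M y = (level M x).+1].
Proof.
move=> xX yX exy lx; have h1 := level_adj yX exy lx.
have h2 : (level M x <= (level M y).+1)%N.
  have [/(level_adj xX)|] := ltnP (level M y).+1 M; last by lia.
  by rewrite e_sym; apply.
have : [|| (level M y).+1 == level M x, level M y == level M x |
      level M y == (level M x).+1] by lia.
by case/or3P=> /eqP; [constructor 1|constructor 2|constructor 3].
Qed.

End Layers.

(** * The numerical bound *)

Section Numbers.

Variables (R : realType) (l : nat).
Hypothesis l0 : (0 < l)%N.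

Definition spread (d : nat) : R := 1 + rho R l d + (rho R l d)^-1.

(** The exceptional value 1 at d = 0 serves isolated vertices; it keeps the
    quotient of consecutive values at least 2l from the start. *)
Definition ramsey_bound (d : nat) : R :=
  if d is d'.+1 then
    2 * l%:R * (2 * l%:R - 1) ^+ d' * \prod_(2 <= j < d'.+2) spread j
  else 1.

Lemma rho_ge1 d : 1 <= rho R l d.
Proof. by have [[]] := rho_min R d l0. Qed.

Lemma rho_le d q : (d <= q)%N -> rho R l d <= rho R l q.
Proof.
move=> dq; have [_ dmin] := rho_min R d l0; apply: dmin.
have [[q1 qs] _] := rho_min R q l0; split=> //.
by apply: le_trans qs; rewrite ler_nat.
Qed.

(** x + 1/x is increasing for x >= 1. *)
Lemma spread_le d q : (d <= q)%N -> spread d <= spread q.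
Proof.
move=> /rho_le; rewrite /spread.
have := rho_ge1 d; have := rho_ge1 q; move: (rho R l d) (rho R l q) => a b b1 a1 ab.
have a0 : 0 < a by lra.
have b0 : 0 < b by lra.
rewrite -subr_ge0.
have -> : 1 + b + b^-1 - (1 + a + a^-1) = (b - a) * (a * b - 1) / (a * b).
  by field; rewrite !gt_eqF.
apply: divr_ge0; last by rewrite mulr_ge0 ?ltW.
apply: mulr_ge0; first by lra.
by rewrite subr_ge0 -[1]mulr1 ler_pM.
Qed.

Lemma spread_ge2 d : 2 <= spread d.
Proof.
rewrite /spread; have r1 := rho_ge1 d.
have : 0 <= (rho R l d)^-1 by rewrite invr_ge0; lra.
by lra.
Qed.

Lemma l_ge1 : 1 <= l%:R :> R.
Proof. by rewrite ler1n. Qed.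

Lemma ramsey_bound_gt0 d : 0 < ramsey_bound d.
Proof.
have l1 := l_ge1.
case: d => [|d] //=; apply: mulr_gt0; last first.
  by apply: prodr_gt0 => j _; have := spread_ge2 j; lra.
by apply: mulr_gt0; [lra | apply: exprn_gt0; lra].
Qed.

Lemma ramsey_boundS d : (0 < d)%N ->
  ramsey_bound d.+1 = ramsey_bound d * ((2 * l%:R - 1) * spread d.+1).
Proof.
case: d => // d _; rewrite /ramsey_bound big_nat_recr //= exprSr.
by ring.
Qed.

Lemma ramsey_bound_step d : 2 * l%:R * ramsey_bound d <= ramsey_bound d.+1.
Proof.
have l1 := l_ge1; case: d => [|d]; first by rewrite /= big_geq // expr0 !mulr1.
rewrite (@ramsey_boundS d.+1) // mulrC; apply: ler_wpM2l; first exact/ltW/ramsey_bound_gt0.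
have := spread_ge2 d.+2; nra.
Qed.

Lemma ramsey_bound_le d q : (d <= q)%N -> ramsey_bound d <= ramsey_bound q.
Proof.
move/subnK <-; elim: (q - d)%N => [|i IHi] //.
apply: le_trans IHi _; rewrite addSn; apply: le_trans (ramsey_bound_step _).
have := ramsey_bound_gt0 (i + d); have := l_ge1; nra.
Qed.

(** Growth by factors above r from a 1 on would make the sum exceed
    (1 + r + ... + r^l) a 1.  Taking the first step of slow growth makes all
    previous ones fast. *)
Lemma slow_growth (r d : R) (a : nat -> R) :
    1 <= r -> d <= \sum_(0 <= i < l.+1) r ^+ i -> 0 < a 1%N ->
    \sum_(0 <= j < l.+1) a j.+1 <= d * a 1%N ->
  exists i, [/\ (i <= l)%N, a i.+1 <= r * a i &
    forall j, (j < i)%N -> r * a j < a j.+1].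
Proof.
move=> r1 dle a1 ale.
have exi : exists i, (i <= l)%N && (a i.+1 <= r * a i).
  have [/existsP[i Pi]|/existsPn H] :=
    boolP [exists i : 'I_l.+1, a i.+1 <= r * a i].
    by exists i; rewrite -ltnS ltn_ord Pi.
  have {}H i : (i <= l)%N -> r * a i < a i.+1.
    by move=> il; have := H (Ordinal (il : i < l.+1)%N); rewrite -ltNge.
  have G i : (i <= l)%N -> r ^+ i * a 1%N <= a i.+1.
    elim: i => [|i IHi] il; first by rewrite expr0 mul1r.
    apply: le_trans (ltW (H _ il)); rewrite exprS -mulrA.
    by apply: ler_wpM2l; [lra | apply: IHi; exact: ltnW].
  suff : d * a 1%N < \sum_(0 <= j < l.+1) a j.+1 by lra.
  apply: (@le_lt_trans _ _ ((\sum_(0 <= i < l.+1) r ^+ i) * a 1%N)).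
    by apply: ler_wpM2r dle; exact: ltW.
  rewrite mulr_suml !big_nat_recl // expr0 mul1r ltrD2l.
  apply: ltr_sum_nat => // i /andP[_ il].
  apply: le_lt_trans (H _ il); rewrite exprS -mulrA.
  by apply: ler_wpM2l; [lra | apply: G; exact: ltnW].
case: (ex_minnP exi) => i /andP[il Pi] imin.
exists i; split=> // j ji; rewrite ltNge; apply/negP => Pj.
by have := imin j; rewrite Pj (leq_trans (ltnW ji) il) => /(_ isT); lia.
Qed.

End Numbers.

(** * The weighted inequality *)

Section WeightedInequality.

Variables (R : realType) (l : nat) (T K : finType) (E : K -> rel T).
Hypothesis l0 : (0 < l)%N.
Hypothesis E_sym : forall c, symmetric (E c).
Hypothesis E_irr : forall c, irreflexive (E c).
Hypothesis E_total : forall x y, x != y -> exists c, E c x y.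
Hypothesis E_free : forall c, ~ has_cycle (E c) l.*2.+1.

Definition colours (X : {set T}) (u : T) : {set K} :=
  [set c | [exists y in X, E c u y]].

Definition weight (X : {set T}) (u : T) : R := (ramsey_bound R l #|colours X u|)^-1.

Lemma coloursP (X : {set T}) u c :
  reflect (exists2 y, y \in X & E c u y) (c \in colours X u).
Proof. by rewrite inE; apply: exists_inP. Qed.

Lemma colours_sub (X X' : {set T}) u :
  X' \subset X -> colours X' u \subset colours X u.
Proof.
move=> sX; apply/subsetP => c /coloursP[y yX Ey]; apply/coloursP.
by exists y => //; apply: (subsetP sX).
Qed.

Lemma colours_lt (X X' : {set T}) u c :
    X' \subset X -> c \in colours X u -> c \notin colours X' u ->
  (#|colours X' u| < #|colours X u|)%N.
Proof.
move=> sX cX cX'; apply: proper_card; apply/properP; split.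
  exact: colours_sub.
by exists c.
Qed.

Lemma weight_gt0 X u : 0 < weight X u.
Proof. by rewrite invr_gt0 ramsey_bound_gt0. Qed.

Lemma weight_le X X' u : (#|colours X' u| <= #|colours X u|)%N ->
  weight X u <= weight X' u.
Proof. by move=> le; rewrite lef_pV2 ?posrE ?ramsey_bound_gt0 // ramsey_bound_le. Qed.

(** Here v is joined to all other vertices in its only colour c.  A
    c-independent J in X - v loses the colour c when X shrinks to J, which
    multiplies its weight by at least 2l; hence w(J) <= 1/2l, while X - v
    weighs more than 1 - 1/2l if the inequality fails. *)
Lemma sum_weight_le1_one (X : {set T}) (v : T) :
    (forall J : {set T}, (#|J| < #|X|)%N -> \sum_(u in J) weight J u <= 1) ->
    v \in X -> #|colours X v| = 1%N ->
  \sum_(u in X) weight X u <= 1.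
Proof.
move=> IH vX /eqP/cards1P[c Cv].
have l1 := l_ge1 R l0.
have vE u : u \in X -> u != v -> E c v u.
  move=> uX; rewrite eq_sym => /E_total[c' Ec'].
  suff /eqP<- : c' == c by [].
  by rewrite -in_set1 -Cv; apply/coloursP; exists u.
rewrite leNgt; apply/negP => wX.
have wv : weight X v = (2 * l%:R)^-1.
  by rewrite /weight Cv cards1 /= expr0 big_geq // !mulr1.
have lnz : l%:R != 0 :> R by rewrite pnatr_eq0 -lt0n.
have [|J sJ indJ||p [szp pX sp]] := @indep_or_path R T (E c) (@enum_rank T)
    (weight X) (E_sym c) _ l.*2.-1 (2 * l%:R)^-1 (X :\ v).
- move=> x y; apply: contraTneq => /val_inj/enum_rank_inj->.
  by rewrite E_irr.
- have sJX : J \subset X by apply: subset_trans sJ (subsetDl _ _).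
  have ltJ : (#|J| < #|X|)%N.
    apply: proper_card; apply/properP; split=> //; exists v => //.
    by apply/negP => /(subsetP sJ); rewrite !inE eqxx.
  apply: (@le_trans _ _ (\sum_(u in J) (2 * l%:R)^-1 * weight J u)); last first.
    rewrite -mulr_sumr -[leRHS]mulr1; apply: ler_wpM2l; last exact: IH.
    by rewrite invr_ge0; lra.
  apply: ler_sum => u uJ; rewrite /weight -invfM lef_pV2; last 2 first.
  + by rewrite posrE ramsey_bound_gt0.
  + by rewrite posrE mulr_gt0 ?ramsey_bound_gt0 //; lra.
  apply: le_trans (ramsey_bound_step _ l0 _) _; apply: ramsey_bound_le => //.
  have := subsetP sJ u uJ; rewrite !inE => /andP[uv uX].
  apply: (@colours_lt _ _ _ c) => //.
    by apply/coloursP; exists v => //; rewrite E_sym vE.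
  by apply/coloursP => -[y yJ]; apply/negP; apply: indJ.
- move: wX; rewrite (big_setD1 v vX) /= wv => wX.
  have -> : l.*2.-1%:R = 2 * l%:R - 1 :> R.
    by rewrite -subn1 natrB ?double_gt0 // -mul2n natrM.
  have e1 : 2 * l%:R * (2 * l%:R)^-1 = 1 :> R by rewrite mulfV // mulf_neq0 // pnatr_eq0.
  by rewrite mulrBl mul1r e1; lra.
- apply: (E_free (c := c)).
  have skey : sorted (fun x y : T => (enum_rank x < enum_rank y)%N) p.
    by apply: sub_sorted sp => x y /andP[].
  have up : uniq p.
    apply: (sorted_uniq _ _ skey); first by move=> y x z; apply: ltn_trans.
    by move=> x; rewrite ltnn.
  have sE : sorted (E c) p by apply: sub_sorted sp => x y /andP[].
  have vp x : x \in p -> E c v x /\ x != v.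
    by move/pX; rewrite !inE => /andP[xv xX]; split=> //; apply: vE.
  exists (v :: p); split.
  + by rewrite /= szp prednK // double_gt0.
  + rewrite /= up andbT; apply/negP => /vp[_]; by rewrite eqxx.
  + case: p szp pX sp skey up sE vp => [|x p] szp pX sp skey up sE vp.
      by move: szp; rewrite prednK ?double_gt0 // => /esym/eqP; rewrite double_eq0 (gtn_eqF l0).
    rewrite /= rcons_path; apply/and3P; split=> //.
      by have [] := vp x (mem_head _ _).
    by rewrite E_sym; have [] := vp _ (mem_last x p).
Qed.

(** Pigeonhole: the neighbourhoods of v in its colours cover X - v. *)
Lemma popular_colour (X : {set T}) (v : T) (w : T -> R) :
    (forall x, 0 <= w x) -> (0 < #|colours X v|)%N ->
  exists2 c, c \in colours X v & \sum_(x in X :\ v) w x <=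
     #|colours X v|%:R * \sum_(x in X | E c v x) w x.
Proof.
move=> w0; set C := colours X v => C0.
have [/existsP[c /andP[cC Hc]]|/existsPn H] := boolP [exists c, (c \in C) &&
    (\sum_(x in X :\ v) w x <= #|C|%:R * \sum_(x in X | E c v x) w x)].
  by exists c.
have {}H c : c \in C ->
    #|C|%:R * \sum_(x in X | E c v x) w x < \sum_(x in X :\ v) w x.
  by move=> cC; have := H c; rewrite cC /= -ltNge.
have : \sum_(c in C) #|C|%:R * \sum_(x in X | E c v x) w x <
    \sum_(c in C) \sum_(x in X :\ v) w x.
  apply: ltr_sum H; have /card_gt0P[c cC] := C0.
  by apply/hasP; exists c; rewrite ?mem_index_enum.
rewrite -mulr_sumr sumr_const -[ltRHS]mulr_natl ltr_pM2l ?ltr0n // ltNge => /negP[].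
under [leRHS]eq_bigr do rewrite big_mkcondr.
rewrite exchange_big /= [leRHS](bigID (mem [set v])) /=.
apply: ler_wpDl.
  by apply: sumr_ge0 => x _; apply: sumr_ge0 => c _; case: ifP.
rewrite [leLHS](eq_bigl (fun x => (x \in X) && (x \notin [set v]))); last first.
  by move=> x; rewrite !inE andbC.
apply: ler_sum => x; rewrite inE => /andP[xX]; rewrite eq_sym => /E_total[c Ec].
rewrite (bigD1 c) /=; last by apply/coloursP; exists x.
by rewrite Ec lerDl; apply: sumr_ge0 => c' _; case: ifP.
Qed.

(** The induction hypothesis for (X - D) + J, in which no vertex weighs less
    than in X.  The vertices of J lose the colour c, and since they saw at least
    d colours, their weights grow by the factor (2l-1)(1 + rho_d + 1/rho_d) or
    more.  It is here that d has to be the minimal number of colours. *)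
Lemma prune_weight (X D J : {set T}) (c : K) (d : nat) :
    (forall Y : {set T}, (#|Y| < #|X|)%N -> \sum_(u in Y) weight Y u <= 1) ->
    D \subset X -> J \proper D -> (1 < d)%N ->
    (forall x, x \in J -> (d <= #|colours X x|)%N) ->
    (forall x, x \in J -> c \in colours X x) ->
    (forall x, x \in J -> c \notin colours ((X :\: D) :|: J) x) ->
  (2 * l%:R - 1) * spread R l d * \sum_(x in J) weight X x <=
  1 - \sum_(x in X) weight X x + \sum_(x in D) weight X x.
Proof.
move=> IH sDX /properP[sJD [z zD zJ]] d1 dmin cX cX'.
set X' := (X :\: D) :|: J in cX'.
have l1 := l_ge1 R l0; have S0 := spread_ge2 R l0 d.
have sX' : X' \subset X by rewrite subUset subsetDl (subset_trans sJD).
have dXJ : [disjoint X :\: D & J].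
  by rewrite disjoint_sym (disjointWl sJD) // -setI_eq0 setDE setICA setICr setI0.
have ltX' : (#|X'| < #|X|)%N.
  apply: proper_card; apply/properP; split=> //.
  by exists z; [apply: (subsetP sDX) | rewrite !inE zD].
have le1 : \sum_(x in X :\: D) weight X' x + \sum_(x in J) weight X' x <= 1.
  rewrite -bigU //; apply: le_trans (IH X' ltX').
  by rewrite le_eqVlt; apply/orP; left; apply/eqP/eq_bigl => x; rewrite !inE.
have w1 : \sum_(x in X :\: D) weight X x <= \sum_(x in X :\: D) weight X' x.
  apply: ler_sum => x _; apply: weight_le; apply: subset_leq_card.
  exact: colours_sub.
have w2 : (2 * l%:R - 1) * spread R l d * \sum_(x in J) weight X x <=
    \sum_(x in J) weight X' x.
  rewrite mulr_sumr; apply: ler_sum => x xJ; rewrite /weight.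
  have := colours_lt sX' (cX x xJ) (cX' x xJ); have := dmin x xJ.
  case: #|colours X x| => // q dq lt.
  have B0 := ramsey_bound_gt0 R l0 q.
  rewrite ramsey_boundS; last by rewrite -ltnS (leq_trans d1).
  have le_q : spread R l d <= spread R l q.+1 by apply: spread_le.
  apply: (@le_trans _ _ (ramsey_bound R l q)^-1); last first.
    by rewrite lef_pV2 ?posrE ?ramsey_bound_gt0 // ramsey_bound_le.
  rewrite ler_pdivrMr; last by rewrite !mulr_gt0 //; lra.
  by rewrite mulKf ?gt_eqF // ler_pM2l //; lra.
rewrite [\sum_(x in X) _](big_setID D) /= (setIidPr sDX).
by move: le1 w1 w2; lra.
Qed.

(** D consists of the three layers around the first layer L of slow growth.
    By [prune_weight] the independent subsets of L are so light that L contains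
    an increasing path with 2l vertices. *)
Lemma sum_weight_le1_many (X : {set T}) (v : T) :
    (forall J : {set T}, (#|J| < #|X|)%N -> \sum_(u in J) weight J u <= 1) ->
    v \in X -> (1 < #|colours X v|)%N ->
    (forall u, u \in X -> (#|colours X v| <= #|colours X u|)%N) ->
  \sum_(u in X) weight X u <= 1.
Proof.
move=> IH vX; set d := #|colours X v| => d1 dmin.
have or3 (b1 b2 b3 : bool) (t : R) : 0 <= t ->
    (if [|| b1, b2 | b3] then t else 0) <=
    (if b1 then t else 0) + (if b2 then t else 0) + (if b3 then t else 0).
  by case: b1; case: b2; case: b3 => /= t0; lra.
have l1 := l_ge1 R l0.
rewrite leNgt; apply/negP => wX.
pose w := weight X.
have w0 x : 0 < w x by apply: weight_gt0.
have [|c cC wc] := @popular_colour X v w (fun x => ltW (w0 x)).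
  exact: ltnW d1.
rewrite -/d in wc.
(* Layers up to l+1 have to be told apart from the vertices further away. *)
pose M := l.+2; pose lev := level (E c) X v M.
have lev_v : lev v = 0%N by apply: level_root.
pose a j := \sum_(x in X | lev x == j) w x.
have a_ge0 j : 0 <= a j by apply: sumr_ge0 => x _; apply: ltW.
have a_gt0 j x : x \in X -> lev x = j -> 0 < a j.
  move=> xX /eqP lx; rewrite /a (bigD1 x) ?xX //=.
  by apply: ltr_wpDr => //; apply: sumr_ge0 => y _; apply: ltW.
have a0E : a 0%N = w v.
  rewrite /a (big_pred1 v) // => x /=; apply/andP/eqP => [[_ /eqP]|->].
    exact: level0.
  by rewrite lev_v.
have /coloursP[y1 y1X Ey1] := cC.
have lev1 x : x \in X -> E c v x -> lev x = 1%N.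
  move=> xX Ex; have := @level_adj _ (E c) X v M v x xX Ex.
  rewrite -/lev lev_v => /(_ isT) lx1; apply/eqP; rewrite eqn_leq lx1 lt0n.
  by apply: contraTneq Ex => /level0 ->; rewrite E_irr.
have a1 : 0 < a 1%N by apply: (a_gt0 _ y1) => //; apply: lev1.
have wN : \sum_(x in X | E c v x) w x <= a 1%N.
  rewrite /a [leLHS]big_mkcondr [leRHS]big_mkcondr /=; apply: ler_sum => x xX.
  case: ifP => [Ex|_]; first by rewrite lev1.
  by case: ifP => // _; apply: ltW.
have suma : \sum_(0 <= j < l.+2) a j <= \sum_(x in X) w x.
  rewrite big_mkord /a; under eq_bigr do rewrite big_mkcondr /=.
  rewrite exchange_big /=; apply: ler_sum => x xX.
  rewrite -big_mkcond /=.
  have [lx|lx] := ltnP (lev x) l.+2.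
    by rewrite (big_pred1 (Ordinal lx)).
  rewrite big_pred0; first exact: ltW.
  by move=> j; apply: gtn_eqF; apply: leq_trans lx.
have [[r1 rd] _] := rho_min R d l0; set r := rho R l d in r1 rd.
have [|i [il ai agt]] := @slow_growth R l l0 r d%:R a r1 rd a1.
  have := suma; rewrite big_nat_recl // a0E (big_setD1 v vX) /= lerD2l => h.
  apply: (le_trans h); apply: (le_trans wc); exact: ler_wpM2l.
have apos j : (j <= i)%N -> 0 < a j.
  elim: j => [|j IHj] ji; first by rewrite a0E.
  apply: lt_trans (agt j ji); apply: mulr_gt0; [lra | apply: IHj; exact: ltnW].
pose D := [set x in X | [|| (lev x).+1 == i, lev x == i | lev x == i.+1]].
pose L := [set x in X | lev x == i].
have sDX : D \subset X by apply/subsetP => x; rewrite inE => /andP[].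
have sLD : L \subset D.
  by apply/subsetP => x; rewrite !inE => /andP[-> ->]; rewrite orbT.
have wL : \sum_(x in L) w x = a i by apply: eq_bigl => x; rewrite inE.
have wD : \sum_(x in D) w x <= spread R l d * a i.
  apply: (@le_trans _ _ (\sum_(x in X | (lev x).+1 == i) w x + a i + a i.+1)).
    rewrite /a [X in _ <= X + _ + _]big_mkcondr [X in _ <= _ + X + _]big_mkcondr.
    rewrite [X in _ <= _ + _ + X]big_mkcondr -!big_split /=.
    rewrite (eq_bigl (fun x => (x \in X) &&
      [|| (lev x).+1 == i, lev x == i | lev x == i.+1])); last first.
      by move=> x; rewrite inE.
    rewrite big_mkcondr; apply: ler_sum => x _; have := w0 x.
    by move/ltW; apply: or3.
  have prev : \sum_(x in X | (lev x).+1 == i) w x <= r^-1 * a i.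
    case: i il ai agt apos {D L sDX sLD wL} => [|i] il ai agt apos.
      by rewrite big_pred0 ?mulr_ge0 ?invr_ge0 //; [lra | move=> x; rewrite andbF].
    rewrite mulrC ler_pdivlMr; last by lra.
    by rewrite mulrC; apply/ltW/agt.
  have -> : spread R l d * a i = r^-1 * a i + a i + r * a i.
    by rewrite /spread -/r; ring.
  by rewrite !lerD.
have indw (J : {set T}) : J \subset L -> indep (E c) J ->
    (2 * l%:R - 1) * spread R l d * \sum_(x in J) w x <=
    1 - \sum_(x in X) w x + \sum_(x in D) w x.
  move=> sJL indJ; have levJ x : x \in J -> x \in X /\ lev x = i.
    by move=> /(subsetP sJL); rewrite inE => /andP[xX /eqP].
  apply: (prune_weight (c := c)) => //.
  - apply/properP; split; first exact: subset_trans sJL sLD.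
    suff [x xD xL] : exists2 x, x \in D & lev x != i.
      by exists x => //; apply: contra xL => /levJ[_ ->].
    case: (posnP i) => [i0|i0].
      exists y1; last by rewrite i0 lev1.
      by rewrite inE y1X i0 lev1.
    have := apos i.-1 (leq_pred i); rewrite /a.
    have [/existsP[x /andP[xX /eqP lx]] _|/existsPn N] :=
      boolP [exists x, (x \in X) && (lev x == i.-1)].
      exists x; last by rewrite lx neq_ltn ltn_predL i0.
      by rewrite inE xX lx prednK // eqxx.
    by rewrite big_pred0 ?ltxx // => x; apply/negbTE.
  - by move=> x /levJ[xX _]; apply: dmin.
  - move=> x /levJ[xX lx]; apply/coloursP; case: (posnP i) => [i0|i0].
      by exists y1 => //; rewrite i0 in lx; rewrite (level0 lx).
    have [|y [yX _ Ey]] := @level_parent _ (E c) X v M x vX.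
      by rewrite -/lev lx i0; apply: leq_trans (leqnSn _).
    by exists y => //; rewrite E_sym.
  - move=> x xJ; have [xX lx] := levJ x xJ.
    apply/coloursP => -[y]; rewrite inE => /orP[|yJ Exy]; last first.
      by have := indJ x y xJ yJ; rewrite Exy.
    rewrite inE => /andP[yD yX] Exy; case/negP: yD; rewrite inE yX /=.
    have [] := @level_adj_eq _ (E c) X v (E_sym c) M x y xX yX Exy.
    + by rewrite -/lev lx.
    + by rewrite -/lev lx => ->; rewrite eqxx.
    + by rewrite -/lev lx => ->; rewrite eqxx orbT.
    + by rewrite -/lev lx => ->; rewrite eqxx !orbT.
have S2 := spread_ge2 R l0 d.
pose A : R := 2 * l%:R - 1; have A0 : 0 < A by rewrite /A; lra.
have AS0 : 0 < A * spread R l d.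
  by apply: mulr_gt0 => //; apply: lt_le_trans S2.
(* The bound on the weight of independent subsets of L that indw provides. *)
pose b := (1 - \sum_(x in X) w x + \sum_(x in D) w x) / (A * spread R l d).
have lev_par x : exists y, (0 < lev x < M)%N ->
    (lev y).+1 = lev x /\ E c x y.
  have [lx|_] := boolP (0 < lev x < M)%N; last by exists x.
  have [y [_ ly Ey]] := level_parent vX lx.
  by exists y => _; split=> //; rewrite E_sym.
have {lev_par} [par parP] := fin_all_exists lev_par.
have leviM x : (0 < lev x <= i)%N -> (0 < lev x < M)%N.
  by case/andP=> -> lx; apply: leq_ltn_trans lx _; apply: ltnW.
have [|J sJ indJ||p [szp pL sp]] := @indep_or_path R T (E c) (key par i)
    w (E_sym c) _ l.*2.-1 b L.
- by move=> x y; apply: contraTneq => /key_inj->; rewrite E_irr.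
- by rewrite /b ler_pdivlMr // mulrC; apply: indw.
- have -> : l.*2.-1%:R = A.
    by rewrite -subn1 natrB ?double_gt0 // -mul2n natrM.
  rewrite wL /b mulrA ltr_pdivrMr // mulrCA ltr_pM2l // mulrC.
  apply: lt_le_trans wD; rewrite gtrDr subr_lt0; exact: wX.
rewrite prednK ?double_gt0 // in szp.
have levp : {in p, forall x, lev x = i}.
  by move=> x /pL; rewrite inE => /andP[_ /eqP].
(* For i = 0 the layer is {v}, too small for a path with 2l vertices. *)
have [i0|i0] := posnP i.
  have sz1 : (1 < size p)%N by rewrite szp (ltn_Sdouble 0).
  case: p sz1 sp levp {szp pL} => [|x [|y p]] //= _.
  move=> /andP[/andP[_ Exy] _] levp.
  have root z : z \in [:: x, y & p] -> z = v.
    by move/levp; rewrite i0; apply: level0.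
  have xv : x = v by apply: root; apply: mem_head.
  have yv : y = v by apply: root; rewrite in_cons mem_head orbT.
  by rewrite xv yv E_irr in Exy.
apply: (E_free (c := c)).
apply: (@layer_path_cycle T (E c) lev par i (E_sym c) _ _ l v p) => //.
- by move=> x /leviM/parP[].
- by move=> x /leviM/parP[].
- by move=> z; apply: level0.
- by rewrite i0 il.
Qed.

Lemma sum_weight_le1 (X : {set T}) : \sum_(u in X) weight X u <= 1.
Proof.
have [n] := ubnP #|X|; elim: n X => // n IHn X /ltnSE le_Xn.
have IH (Y : {set T}) : (#|Y| < #|X|)%N -> \sum_(u in Y) weight Y u <= 1.
  by move=> YX; apply: IHn; apply: leq_trans YX le_Xn.
have [->|[v0 v0X]] := set_0Vmem X; first by rewrite big_set0.
have [v vX vmin] := arg_minnP (fun u => #|colours X u|) v0X.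
have [C0|C1|C1] := ltngtP #|colours X v| 1%N.
- (* Any two vertices are joined, so only a lone vertex sees no colour. *)
  have XE : X = [set v].
    apply/setP => u; rewrite inE; apply/idP/eqP => [uX|->//].
    apply/eqP; apply: contraTT C0; rewrite eq_sym => /E_total[c Ec].
    by rewrite -leqNgt card_gt0; apply/set0Pn; exists c; apply/coloursP; exists u.
  move: C0; rewrite ltnS leqn0 => /eqP C0.
  by rewrite XE big_set1 -XE /weight C0 invr1.
- exact: sum_weight_le1_many vX C1 vmin.
- exact: sum_weight_le1_one vX C1.
Qed.

Lemma card_le_ramsey_bound : #|T|%:R <= ramsey_bound R l #|K|.
Proof.
have := sum_weight_le1 [set: T].
have B0 := ramsey_bound_gt0 R l0 #|K|.
suff le : #|T|%:R * (ramsey_bound R l #|K|)^-1 <= \sum_(u in [set: T]) weight [set: T] u.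
  by move/(le_trans le); rewrite ler_pdivrMr // mul1r.
rewrite mulr_natl -[#|T|]cardsT -sumr_const; apply: ler_sum => u _.
by rewrite lef_pV2 ?posrE ?ramsey_bound_gt0 // ramsey_bound_le // max_card.
Qed.

End WeightedInequality.

(** * From colourings to coverings by graphs *)

Lemma mono_copy_cycle (k m n : nat) (c : {ffun {set 'I_n} -> 'I_k}) (i : 'I_k) :
  (0 < m)%N ->
  has_cycle (fun x y => (x != y) && (c [set x; y] == i)) m ->
  mono_copy (cycle_graph m) c.
Proof.
case: m => // m _ [p [szp up cp]].
case: p szp up cp => // x0 p' szp' up cp; set p := x0 :: p' in szp' up cp *.
have step (a : 'I_m.+1) : c [set nth x0 p a; nth x0 p (ordS a)] == i.
  have am : nth x0 p a \in p by rewrite mem_nth ?szp'.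
  have /andP[_] := next_cycle cp am.
  rewrite next_nth am index_uniq ?szp' // /p /=.
  have [am'|] := ltnP a m.
    by rewrite modn_small.
  rewrite leq_eqVlt ltnNge -ltnS ltn_ord orbF => /eqP ma.
  rewrite [nth x0 p' a]nth_default; last by rewrite -ma -ltnS -szp'.
  by rewrite -ma modnn.
apply/existsP; exists i; apply/existsP; exists [ffun u : 'I_m.+1 => nth x0 p u].
apply/andP; split.
  apply/injectiveP => u v; rewrite !ffunE => /eqP.
  by rewrite nth_uniq ?szp' ?ltn_ord // => /eqP/val_inj.
apply/forallP => u; apply/forallP => v; apply/implyP => /andP[_].
by rewrite !ffunE => /orP[/eqP->|/eqP->]; rewrite // setUC.
Qed.

Theorem theorem4 (R : realType) (k l : nat) (hk : (0 < k)%N) (hl : (0 < l)%N) :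
  (ramsey k (cycle_graph (2 * l + 1)))%:Z <=
    Num.floor ((2 * l%:R) * (2 * l%:R - 1) ^+ (k - 1) *
      \prod_(2 <= d < k.+1) (1 + rho R l d + (rho R l d)^-1)) + 1.
Proof.
have -> : (2 * l%:R) * (2 * l%:R - 1) ^+ (k - 1) *
    \prod_(2 <= d < k.+1) (1 + rho R l d + (rho R l d)^-1) = ramsey_bound R l k.
  by case: k hk => // k _; rewrite subn1.
set N := Num.floor _.
have N0 : 0 <= N by rewrite /N floor_ge0 ltW // ramsey_bound_gt0.
have Nn0 : N + 1 = (`|N|.+1)%N%:Z by rewrite -addn1 PoszD gez0_abs.
rewrite Nn0 lez_nat /ramsey; case: ex_minnP => n _; apply; apply/forallP => c.
set n0 := `|N|.+1 in c *.
apply: contraT => nomono; exfalso.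
pose E (i : 'I_k) := fun x y : 'I_n0 => (x != y) && (c [set x; y] == i).
have : n0%:R <= ramsey_bound R l k.
  rewrite -[n0]card_ord -[in ramsey_bound _ _ k](card_ord k).
  apply: (@card_le_ramsey_bound R l 'I_n0 'I_k E hl).
  - by move=> i x y; rewrite /E eq_sym setUC.
  - by move=> i x; rewrite /E eqxx.
  - by move=> x y xy; exists (c [set x; y]); rewrite /E xy eqxx.
  - move=> i cyc; case/negP: nomono; apply: (mono_copy_cycle (i := i)).
      by rewrite addn1.
    by rewrite mul2n addn1.
by rewrite leNgt => /negP[]; have := floorD1_gt (ramsey_bound R l k); rewrite -/N Nn0.
Qed.
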